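(* Let $Q$ be a local quantale. Then the quantale space of (proper) regular ideals of $Q$ is quasi-compact.
   Context: A quantale here means a complete lattice $(Q,\preccurlyeq,\bot,\top)$ with a binary operation $\&$ that is associative, commutative, satisfies $x\&\bigl(\bigvee_{\lambda} y_\lambda\bigr)=\bigvee_\lambda (x\& y_\lambda)$ for all families, and satisfies $x\&\top=x$ for all $x$. An ideal of $Q$ is a nonempty subset $I\subseteq Q$ such that $x,y\in I$ implies $x\vee y\in I$, and $x\in I$, $l\preccurlyeq x$ imply $l\in I$. $\mathcal I_Q$ is the set of all ideals of $Q$. An ideal is proper if $I\neq Q$; a maximal ideal is a proper ideal not properly contained in any other proper ideal. $Q$ is local if it has exactly one maximal ideal. An element $x\in Q$ is a zero-divisor if $x\& y=\bot$ for some $y\neq\bot$, and regular otherwise; an ideal is regular if it contains a regular element. For a set $\Sigma_Q$ of proper ideals of $Q$ and $X\subseteq \mathcal I_Q$, put $X^{\uparrow}=\{J\in\Sigma_Q\mid \bigcap X\subseteq J\}$ if $X\neq\emptyset$ and $\emptyset^{\uparrow}=\emptyset$. The quantale topology on $\Sigma_Q$ is the topology having the sets $X^{\uparrow}$ ($X\subseteq \mathcal I_Q$) as a subbasis of closed sets; $\Sigma_Q$ with this topology is called a quantale space. A space is quasi-compact if every open cover has a finite subcover (no Hausdorff assumption); the empty space is quasi-compact. *)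

(* Defs.v *)
From HB Require Import structures.
From mathcomp Require Import all_boot all_order.
From mathcomp Require Import boolp classical_sets topology.

Set Implicit Arguments.
Unset Strict Implicit.
Unset Printing Implicit Defensive.

Import Order.TTheory.
Local Open Scope classical_set_scope.
Local Open Scope order_scope.

HB.mixin Record TBLattice_isComplete (d : Order.disp_t) T
    of Order.TBLattice d T := {
  Sup : set T -> T ;
  SupP : forall A : set T, supremums A (Sup A)
}.

#[short(type="completeLatticeType")]
HB.structure Definition CompleteLattice (d : Order.disp_t) :=
  { T of Order.TBLattice d T & TBLattice_isComplete d T }.

(* The join of a family is the join of its range, so distributivity over
   arbitrary families is stated for subsets, including the empty one. *)
HB.mixin Record CompleteLattice_isQuantale (d : Order.disp_t) T
    of CompleteLattice d T := {
  qmul : T -> T -> T ;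
  qmulA : associative qmul ;
  qmulC : commutative qmul ;
  qmul_Sup : forall (x : T) (A : set T),
    qmul x (Sup A) = Sup [set qmul x y | y in A] ;
  qmulT : right_id (\top : T) qmul
}.

#[short(type="quantaleType")]
HB.structure Definition Quantale (d : Order.disp_t) :=
  { T of CompleteLattice d T & CompleteLattice_isQuantale d T }.

Definition is_ideal (d : Order.disp_t) (Q : quantaleType d) (I : set Q) : Prop :=
  [/\ I !=set0,
      forall x y : Q, I x -> I y -> I (x `|` y)
    & forall x l : Q, I x -> l <= x -> I l].

Definition proper_ideal (d : Order.disp_t) (Q : quantaleType d)
    (I : set Q) : Prop :=
  is_ideal I /\ I <> [set: Q].

Definition maximal_ideal (d : Order.disp_t) (Q : quantaleType d)
    (M : set Q) : Prop :=
  proper_ideal M /\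
  ~ (exists2 J : set Q, proper_ideal J & M `<` J).

Definition local_quantale (d : Order.disp_t) (Q : quantaleType d) : Prop :=
  exists! M : set Q, maximal_ideal M.

Definition zero_divisor (d : Order.disp_t) (Q : quantaleType d) (x : Q) : Prop :=
  exists2 y : Q, y <> \bot & qmul x y = \bot.

Definition regular_elt (d : Order.disp_t) (Q : quantaleType d) (x : Q) : Prop :=
  ~ zero_divisor x.

Definition regular_ideal (d : Order.disp_t) (Q : quantaleType d)
    (I : set Q) : Prop :=
  is_ideal I /\ exists2 x : Q, I x & regular_elt x.

(* The points of [quantale_space S] are the proper ideals of [Q] that belong
   to [S]; every set of proper ideals is obtained in this way. *)
Record quantale_space (d : Order.disp_t) (Q : quantaleType d)
    (S : set (set Q)) : Type := QuantalePoint {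
  point_ideal : set Q ;
  point_proper : proper_ideal point_ideal ;
  point_mem : S point_ideal
}.

Definition upset (d : Order.disp_t) (Q : quantaleType d) (S : set (set Q))
    (X : set (set Q)) : set (quantale_space S) :=
  [set J | X !=set0 /\ \bigcap_(I in X) I `<=` point_ideal J].

Section QuantaleTopology.
Variables (d : Order.disp_t) (Q : quantaleType d) (S : set (set Q)).

HB.instance Definition _ := gen_eqMixin (quantale_space S).
HB.instance Definition _ := gen_choiceMixin (quantale_space S).

(* The library builds topologies from open subbases: the subbasic open sets
   are the complements of the [upset X], for [X] a set of ideals. *)
HB.instance Definition _ := isSubBaseTopological.Build (quantale_space S)
  [set X : set (set Q) | X `<=` @is_ideal d Q]
  (fun X => ~` upset X).

End QuantaleTopology.

(* Main.v *)
Require Import Defs.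
From mathcomp Require Import all_boot all_order.
From mathcomp Require Import finmap.
From mathcomp Require Import boolp classical_sets topology.
Import Order.Theory.
Local Open Scope classical_set_scope.

(** By Zorn's lemma the unique maximal ideal [M] of a local quantale contains
    every proper ideal.  If the space of proper regular ideals is nonempty, then
    [M] is therefore regular and belongs to every nonempty subbasic closed set,
    so the only open neighbourhood of the point [M] is the whole space: any
    member of an open cover that contains [M] is already a cover. *)

Section Ideals.
Context {d : Order.disp_t} {Q : quantaleType d}.
Implicit Types I J M : set Q.

(** Downward closure makes an ideal containing [\top] all of [Q]. Properness in this form is tested
    at one element, so it passes to unions of chains. *)
Lemma proper_idealP I : proper_ideal I <-> is_ideal I /\ ~ I \top%O.
Proof.
split=> -[idI nI]; split=> //.
  move=> It; apply: nI; rewrite -subTset => x _.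
  by case: idI => _ _ dI; apply: (dI _ _ It); exact: lex1.
by move=> IT; apply: nI; rewrite IT.
Qed.

(** Joining [I] to every set keeps the union nonempty for the empty chain, which Zorn's lemma also
    requires. *)
Lemma proper_ideal_setU_chain I (F : set (set Q)) :
  proper_ideal I -> (forall X, F X -> proper_ideal (I `|` X)) ->
  total_on F subset -> proper_ideal (I `|` \bigcup_(X in F) X).
Proof.
move=> pI FP totF.
(* The option [X = set0] serves the elements of [I], so an empty [F] needs no separate case. *)
have wit x : (I `|` \bigcup_(X in F) X) x ->
    exists X, [/\ X = set0 \/ F X, proper_ideal (I `|` X) & (I `|` X) x].
  move=> [Ix|[X FX Xx]].
    by exists set0; split; [left | rewrite setU0 | left].
  by exists X; split; [right | exact: FP | right].
have sub X : X = set0 \/ F X ->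
    I `|` X `<=` I `|` \bigcup_(Y in F) Y.
  by move=> FX; apply: setUS => y Xy; case: FX Xy => [->|FX] // Xy; exists X.
apply/proper_idealP; split; last first.
  by move=> /wit[X [_ /proper_idealP[_ nX]]].
split.
- by case: pI => -[[x Ix] _ _] _; exists x; left.
- move=> x y /wit[X [FX [[_ jX _] _] Xx]] /wit[Y [FY [[_ jY _] _] Yy]].
  have [XY|YX] : X `<=` Y \/ Y `<=` X.
    case: FX => [->|FX]; first by left; exact: sub0set.
    case: FY => [->|FY]; first by right; exact: sub0set.
    exact: totF.
  + by apply: (sub _ FY); apply: jY => //; apply: setUS Xx.
  + by apply: (sub _ FX); apply: jX => //; apply: setUS Yy.
- move=> x l /wit[X [FX [[_ _ dX] _] Xx]] lx.
  by apply: (sub _ FX); exact: dX Xx lx.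
Qed.

Lemma proper_ideal_sub_maximal I :
  proper_ideal I -> exists2 M, maximal_ideal M & I `<=` M.
Proof.
move=> pI.
have [F FP totF|A [pA maxA]] :=
  @Zorn_bigcup Q [set X | proper_ideal (I `|` X)].
  exact: proper_ideal_setU_chain.
exists (I `|` A); last exact: subsetUl.
split=> // -[J pJ []]; rewrite subUset => -[IJ AJ] nJ.
(* As [J] contains [I], the set [I] joined to [J] is [J] itself, so [J] lies in the Zorn family
   strictly above [A]. *)
apply: (maxA J) => /=; last by rewrite (setUidr IJ).
by split=> // JA; apply: nJ; apply: (subset_trans JA); exact: subsetUr.
Qed.

Lemma local_quantale_sub_maximal :
  local_quantale Q ->
  exists2 M, maximal_ideal M & forall I, proper_ideal I -> I `<=` M.
Proof.
move=> [M [maxM uniqM]]; exists M => // I /proper_ideal_sub_maximal[N maxN].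
by rewrite -(uniqM _ maxN).
Qed.

Lemma open_greatest_point (S : set (set Q)) (m : quantale_space S)
    (U : set (quantale_space S)) :
  (forall J : quantale_space S, point_ideal J `<=` point_ideal m) ->
  open U -> U m -> U = setT.
Proof.
move=> maxm [B sB <-] [V BV Vm]; rewrite -subTset => J _; exists V => //.
have [D _ defV] := sB _ BV; rewrite -defV in Vm *.
move=> X DX; suff: ~ upset X J by [].
move=> [X0 XJ]; suff: upset X m by exact: (Vm X DX).
by split=> //; exact: subset_trans XJ (maxm J).
Qed.

End Ideals.

Lemma cover_compact_subset_nbhs (T : topologicalType) (A : set T) (m : T) :
  A m -> (forall U, open U -> U m -> A `<=` U) -> cover_compact A.
Proof.
move=> Am nbhsA I D f fo /[dup] Af /(_ _ Am)[i Di fim].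
exists [fset i]%fset; first by move=> j; rewrite !inE => /eqP ->.
by move=> x Ax; exists i; [rewrite /= inE | exact: nbhsA (fo _ Di) fim _ Ax].
Qed.

Theorem proposition4p8 (d : Order.disp_t) (Q : quantaleType d)
    (hQ : local_quantale Q) :
  cover_compact [set: quantale_space (@regular_ideal d Q)].
Proof.
have [M [pM _] maxM] := local_quantale_sub_maximal hQ.
(* The empty space has the empty subcover; otherwise a point [J] supplies the regular element of
   [M]. *)
have [->|/set0P[J _]] := eqVneq [set: quantale_space (@regular_ideal d Q)] set0.
  by move=> I D f _ _; exists fset0; [move=> i; rewrite inE | exact: sub0set].
have regM : regular_ideal M.
  case: pM => idM _; split=> //; case: (point_mem J) => _ [x Jx regx].
  by exists x => //; exact: maxM (point_proper J) _ Jx.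
apply: (@cover_compact_subset_nbhs _ _ (QuantalePoint pM regM)) => // U oU Um.
by rewrite (open_greatest_point _ _ _ _ oU Um) // => K;
  exact: maxM (point_proper K).
Qed.
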